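(* Let $I=[-\tfrac12,\tfrac12]$ and $\Sigma=I\times I$ with the sup distance. Let $F:\Sigma\to\Sigma$ be a Borel map of the form $F(x,y)=(T(x),G(x,y))$, let $\mu$ be an $F$-invariant Borel probability measure on $\Sigma$, and let $\mu_x=(\pi_x)_*\mu$ be its marginal on the $x$-axis (which is $T$-invariant), where $\pi_x(x,y)=x$. Suppose: (1) there are constants $C>0,\lambda>0$ such that for every $g\in L^1(I)$, every $f:I\to\mathbb{R}$ of bounded variation and every $n\ge 0$, $$\Big|\int g(T^n(x))f(x)\,dm-\int g\,d\mu_x\int f\,dm\Big|\le C\,\|g\|_{L^1}\,\|f\|_{BV}\,e^{-\lambda n},$$ where $m$ is Lebesgue measure on $I$; moreover $T^{-1}(x)$ is finite for every $x\in I$; (2) there is $\lambda_0<1$ such that $|G(x,y_1)-G(x,y_2)|\le\lambda_0|y_1-y_2|$ for all $x,y_1,y_2$; (3) there is a constant $K$ such that for every $\ell$-Lipschitz function $f:\Sigma\to\mathbb{R}$ the measure $(\pi_x)_*(f\mu)$ has a density $\overline f$ of bounded variation with $\operatorname{var}(\overline f)\le K\ell$. Then $(F,\mu)$ has exponential decay of correlations with respect to Lipschitz observables: there are constants $C'>0$, $\rho>0$ such that for all Lipschitz $g:\Sigma\to\mathbb{R}$, all Lipschitz $f:\Sigma\to\mathbb{R}$ with $f\ge 0$, and all $n\ge0$, $$\Big|\int g\circ F^n\, f\,d\mu-\int f\,d\mu\int g\,d\mu\Big|\le C'\,L(g)\,\|f\|_{lip}\,e^{-\rho n}.$$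
   Context: $L(g)=\sup_{p\ne q}|g(p)-g(q)|/d(p,q)$ is the best Lipschitz constant, $\|f\|_{lip}=\|f\|_\infty+L(f)$. $f\mu$ denotes the measure with density $f$ with respect to $\mu$. $\|f\|_{BV}$ is the bounded-variation norm ($\sup|f|$ plus total variation). The paper states the conclusion as ''exponential decay of correlations with respect to Lipschitz and $L^1$ observables''; the displayed inequality is the precise form of this decay. *)

(* Defs.v *)
From HB Require Import structures.
From mathcomp Require Import all_boot all_order all_algebra.
From mathcomp Require Import all_classical all_reals all_analysis.
Set Implicit Arguments. Unset Strict Implicit. Unset Printing Implicit Defensive.
Import Order.TTheory GRing.Theory Num.Theory.
Import numFieldNormedType.Exports.
Local Open Scope classical_set_scope.
Local Open Scope ring_scope.

Section defs.
Context {R : realType}.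

Definition Iset : set R := `[(- 2^-1), 2^-1]%classic.

Definition Sigma : set (R * R) := [set z | Iset z.1 /\ Iset z.2].

Definition supdist (p q : R * R) : R := Num.max `|p.1 - q.1| `|p.2 - q.2|.

Definition lip_with (l : R) (f : R * R -> R) : Prop :=
  forall p q, Sigma p -> Sigma q -> `|f p - f q| <= l * supdist p q.

Definition is_lipschitz (f : R * R -> R) : Prop := exists l, lip_with l f.

Definition Lconst (f : R * R -> R) : \bar R :=
  ereal_sup [set (`|f pq.1 - f pq.2| / supdist pq.1 pq.2)%:E
            | pq in [set pq : (R * R) * (R * R)
                     | [/\ Sigma pq.1, Sigma pq.2 & pq.1 <> pq.2]]].

Definition lipnorm (f : R * R -> R) : \bar R :=
  (ereal_sup [set `|f p|%:E | p in Sigma] + Lconst f)%E.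

Definition BVnorm (f : R -> R) : \bar R :=
  (ereal_sup [set `|f x|%:E | x in Iset] + total_variation (- 2^-1) 2^-1 f)%E.

End defs.

(* Main.v *)
(* Both the fibre contraction and the decay of the base map are used, each for
   half of the time n = k + j.  After k steps the fibres are contracted by
   lam0 ^+ k, so g o F^k is uniformly close to h(x) = g(F^k(x,0)), a function
   of the base coordinate alone.  Hence the integral of g o F^n * f is close to
   that of h(T^j x) f, which hypothesis (3) turns into a Lebesgue integral of
   h(T^j x) fb(x), where hypothesis (1) applies.  The density fb is bounded
   because it oscillates by at most its total variation about its mean
   \int f dmu.  Correlations do not see additive constants of g, so g may be
   centred, which bounds its sup norm by its Lipschitz constant. *)
Require Import Defs.
From HB Require Import structures.
From mathcomp Require Import all_boot all_order all_algebra.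
From mathcomp Require Import all_classical all_reals all_analysis.
From mathcomp Require Import measurable_realfun finmap zify ring lra.
Set Implicit Arguments. Unset Strict Implicit. Unset Printing Implicit Defensive.
Import Order.TTheory GRing.Theory Num.Theory.
Import numFieldNormedType.Exports.
Local Open Scope classical_set_scope.
Local Open Scope ring_scope.

(** * The square [Sigma], its sup distance, and two measurability criteria *)

Lemma measurable_Iset (R : realType) : measurable (@Iset R).
Proof. exact: measurable_itv. Qed.

Lemma SigmaE (R : realType) : @Sigma R = Iset `*` Iset.
Proof. by []. Qed.

Lemma measurable_Sigma (R : realType) : measurable (@Sigma R).
Proof. by rewrite SigmaE; apply: measurableX; exact: measurable_Iset. Qed.

Lemma supdist_lt (R : realType) (p q : R * R) (r : R) :
  (supdist p q < r) = (`|p.1 - q.1| < r) && (`|p.2 - q.2| < r).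
Proof. by rewrite /supdist gt_max. Qed.

Lemma supdist_triangle (R : realType) (p q z : R * R) :
  supdist p q <= supdist p z + supdist z q.
Proof.
rewrite /supdist ge_max; apply/andP; split.
  by rewrite (le_trans (ler_distD z.1 _ _))// lerD// le_max lexx ?orbT.
by rewrite (le_trans (ler_distD z.2 _ _))// lerD// le_max lexx ?orbT.
Qed.

Lemma supdist_ge0 (R : realType) (p q : R * R) : 0 <= supdist p q.
Proof. by rewrite /supdist le_max normr_ge0. Qed.

(** The product sigma-algebra is generated by rectangles, so each superlevel set of [f] is
    exhibited, relative to [Sigma], as a countable union of boxes with rational centre and
    radius. *)
Lemma lipschitz_measurable (R : realType) (f : R * R -> R) :
  is_lipschitz f -> measurable_fun Sigma f.
Proof.
move=> [l0 l0f].
(* A strictly positive Lipschitz constant is wanted because a radius is obtained by dividing by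
   it. *)
pose l := `|l0| + 1.
have l_gt0 : 0 < l by rewrite ltr_wpDl.
have lf p q : Sigma p -> Sigma q -> `|f p - f q| <= l * supdist p q.
  move=> Sp Sq; apply: (le_trans (l0f _ _ Sp Sq)).
  by rewrite ler_wpM2r ?supdist_ge0// (le_trans (ler_norm _))// lerDl.
apply: (measurability (@RGenOInfty.G R)) => [|/= _ [_] [a ->] <-].
  exact: RGenOInfty.measurableE.
pose box (q : rat * rat * rat) : set (R * R) :=
  ball (ratr q.1.1 : R) (ratr q.2) `*` ball (ratr q.1.2 : R) (ratr q.2).
pose good q := box q `&` Sigma `<=` f @^-1` `]a, +oo[%classic.
have -> : Sigma `&` f @^-1` `]a, +oo[%classic =
    Sigma `&` \bigcup_(q in [set: rat * rat * rat])
      if `[< good q >] then box q else set0.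
  apply/seteqP; split => z [Sz]; last first.
    move=> [q _]; case: ifPn => // /asboolP goodq bz.
    by split => //; apply: goodq.
  rewrite /= in_itv/= andbT => afz; split => //.
  (* Two points of a box of radius [r] are less than [2 r] apart, so below this threshold [f] varies
     by less than [f z - a] and stays above [a] on the box. *)
  have e_gt0 : 0 < (f z - a) / l / 2 by rewrite !divr_gt0// subr_gt0.
  have [r] := rat_in_itvoo e_gt0; rewrite in_itv/= => /andP[r_gt0 re].
  have approx x : exists q : rat, `|ratr q - x| < ratr r :> R.
    have [|q] := @rat_in_itvoo R (x - ratr r) (x + ratr r).
      by rewrite ltrBlDr -addrA ltrDl addr_gt0.
    by rewrite in_itv/= => qx; exists q; rewrite ltr_distl.
  have [q1 q1z] := approx z.1.
  have [q2 q2z] := approx z.2.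
  exists (q1, q2, r) => //; case: ifPn => [_|/asboolP]; first by split.
  case => w [[/= w1 w2] Sw]; rewrite /= in_itv/= andbT.
  have dw : supdist z w < ratr r + ratr r.
    apply: le_lt_trans (supdist_triangle _ _ (ratr q1, ratr q2)) _.
    apply: ltrD; rewrite supdist_lt/=.
      by rewrite distrC q1z distrC.
    by rewrite w1.
  have : `|f z - f w| < f z - a.
    apply: (le_lt_trans (lf _ _ Sz Sw)).
    rewrite -ltr_pdivlMl// mulrC (lt_trans dw)//.
    by rewrite [ltRHS]splitr ltrD.
  by rewrite ltr_norml => /andP[_]; rewrite ltrD2l ltrN2.
apply: measurableI; first exact: measurable_Sigma.
apply: countable_bigcupT_measurable => [|q]; first exact: countableP.
case: ifP => _; last exact: measurable0.
by apply: measurableX; exact: measurable_ball.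
Qed.

(** Jordan decomposition: on the interval [f] is a difference of two nondecreasing functions, the
    negative variations of [- f] and of [f], and monotone functions are measurable. *)
Lemma bounded_variation_measurable (R : realType) (a b : R) (f : R -> R) :
  bounded_variation a b f -> measurable_fun `[a, b]%classic f.
Proof.
have [ab|ba] := leP a b; last first.
  by move=> _; rewrite set_itv_ge ?bnd_simp -?ltNge//; exact: measurable_fun_set0.
move=> bvf.
(* Clamping to the interval makes the variation functions monotone on the whole line without
   changing them on the interval. *)
pose c (x : R) := Num.max a (Num.min x b).
have cab x : c x \in `[a, b].
  by rewrite in_itv/= le_max lexx/= ge_max ab ge_min lexx orbT.
have c_nd : {homo c : x y / x <= y}.
  move=> x y xy; rewrite /c ge_max !le_max lexx/=; apply/orP; right.
  by rewrite le_min !ge_min xy lexx !orbT.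
have mneg g : bounded_variation a b g ->
    measurable_fun `[a, b]%classic (fine \o neg_tv a g \o c).
  move=> bvg; apply: nondecreasing_measurable => //.
  by move=> x y xy; apply: (fine_neg_tv_nondecreasing bvg) => //; exact: c_nd.
apply: (eq_measurable_fun ((fine \o neg_tv a (\- f) \o c) \-
                           (fine \o neg_tv a f \o c))).
  move=> x /set_mem /= xab.
  rewrite (bounded_variation_pos_neg_tvE bvf)//.
  have -> //: c x = x.
  move: xab; rewrite in_itv/= => /andP[ax xb].
  by rewrite /c (min_idPl xb) (max_idPr ax).
by apply: measurable_funB; apply: mneg => //; exact: bounded_variationN.
Qed.

(** * Integrability of bounded functions and of their products with integrable ones *)

Lemma bounded_integrable d (X : measurableType d) (R : realType)
    (m : {measure set X -> \bar R}) (D : set X) (u : X -> R) (M : R) :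
  measurable D -> (m D < +oo)%E -> measurable_fun D u ->
  (forall x, D x -> `|u x| <= M) -> m.-integrable D (EFin \o u).
Proof.
move=> mD Dfin mu uM; apply: measurable_bounded_integrable => //.
exists M; split; first exact: num_real.
by move=> r Mr x Dx; exact: le_trans (uM _ Dx) (ltW Mr).
Qed.

Lemma integrable_bounded_mul d (X : measurableType d) (R : realType)
    (m : {measure set X -> \bar R}) (D : set X) (u a : X -> R) (M : R) :
  measurable D -> measurable_fun D u -> (forall x, D x -> `|u x| <= M) ->
  m.-integrable D (EFin \o a) -> m.-integrable D (EFin \o (fun x => u x * a x)).
Proof.
move=> mD mu uM ia.
have ma : measurable_fun D a by apply/measurable_EFinP; exact: measurable_int ia.
apply: (@le_integrable _ _ _ _ _ mD _ (fun x => M%:E * (EFin \o a) x)%E).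
- by apply/measurable_EFinP; exact: measurable_funM.
- move=> x Dx; rewrite /= lee_fin !normrM ler_wpM2r//.
  by rewrite (le_trans (uM _ Dx))// ler_norm.
- exact: integrableZl.
Qed.

(** * Change of variables between two signed weighted measures that agree on sets *)

Section transfer.
Context d1 d2 (X : measurableType d1) (Y : measurableType d2) (R : realType).
Variables (m : {measure set X -> \bar R}) (n : {measure set Y -> \bar R}).
Variables (D : set X) (E : set Y) (p : X -> Y) (a : X -> R) (b : Y -> R).
Hypotheses (mD : measurable D) (mE : measurable E) (mp : measurable_fun D p).
Hypotheses (ia : m.-integrable D (EFin \o a)) (ib : n.-integrable E (EFin \o b)).
Hypothesis ab : forall A, measurable A ->
  (\int[m]_(x in p @^-1` A `&` D) (a x)%:E = \int[n]_(y in A `&` E) (b y)%:E)%E.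

(** Measurability is asked of [A] only inside [C], since preimages under [p] are known to be
    measurable only relative to [D]. *)
Local Lemma integrable_indicM d (Z : measurableType d) (l : {measure set Z -> \bar R})
    (C A : set Z) (c : Z -> R) : measurable C -> measurable (C `&` A) ->
  l.-integrable C (EFin \o c) ->
  l.-integrable C (EFin \o (fun z => \1_A z * c z)).
Proof.
move=> mC mCA ic; apply: (@integrable_bounded_mul _ _ _ _ _ _ _ 1) => //.
  apply/measurable_restrictT => //.
  rewrite [_ \_ _](_ : _ = \1_(C `&` A)); first exact: measurable_indic.
  apply/funext => z; rewrite patchE !indicE in_setI.
  by case: (z \in C).
by move=> z _; rewrite indicE; case: (_ \in _); rewrite ?normr1 ?normr0.
Qed.

Let transfer_indic A : measurable A ->
  (\int[m]_(x in D) (\1_A (p x) * a x)%:E = \int[n]_(y in E) (\1_A y * b y)%:E)%E.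
Proof.
move=> mA; have := ab mA; rewrite setIC integral_mkcondr setIC integral_mkcondr.
move=> ab'; transitivity (\int[m]_(x in D) (((fun x => (a x)%:E) \_ (p @^-1` A)) x))%E.
  apply: eq_integral => x _; rewrite patchE indicE.
  rewrite -[x \in _]/(p x \in A).
  by case: (_ \in _); rewrite ?mul1r ?mul0r.
rewrite ab'; apply: eq_integral => y _; rewrite patchE indicE.
by case: (_ \in _); rewrite ?mul1r ?mul0r.
Qed.

Import HBNNSimple.

Let transfer_nnsfun (s : {nnsfun Y >-> R}) :
  (\int[m]_(x in D) (s (p x) * a x)%:E = \int[n]_(y in E) (s y * b y)%:E)%E.
Proof.
(* A simple function is the finite sum of its values times the indicators of its level sets, which
   reduces the claim to indicators by linearity. *)
have sE y c : (s y * c)%:E = (\sum_(r <- fset_set (range s))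
    (r%:E * (\1_(s @^-1` [set r]) y * c)%:E))%E.
  rewrite [in LHS](fimfunE s) fsbig_finite//= mulr_suml sumEFin.
  by congr EFin; apply: eq_bigr => r _; rewrite mulrA.
have ms r : measurable (s @^-1` [set r]) by [].
have mps r : measurable (D `&` p @^-1` (s @^-1` [set r])) by exact: mp.
have iD r : m.-integrable D
    (EFin \o (fun x => \1_(s @^-1` [set r]) (p x) * a x)).
  have := integrable_indicM mD (mps r) ia; congr (_.-integrable _ _).
have iE r : n.-integrable E
    (EFin \o (fun y => \1_(s @^-1` [set r]) y * b y)).
  by apply: integrable_indicM => //; exact: measurableI.
under eq_integral do rewrite sE.
under [RHS]eq_integral do rewrite sE.
rewrite (integral_sum mD); last by move=> r; exact: integrableZl (iD r).
rewrite (integral_sum mE); last by move=> r; exact: integrableZl (iE r).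
apply: eq_bigr => r _.
rewrite (integralZl mD (iD r)) (integralZl mE (iE r)).
by congr (_ * _)%E; exact: transfer_indic.
Qed.

Lemma transfer_integral (u : Y -> R) (M : R) : p @` D `<=` E ->
  measurable_fun E u -> (forall y, E y -> `|u y| <= M) ->
  (\int[m]_(x in D) (u (p x) * a x)%:E = \int[n]_(y in E) (u y * b y)%:E)%E.
Proof.
move=> pDE mu uM.
have pE x : D x -> E (p x) by move=> Dx; apply: pDE; exists x.
have mup : measurable_fun D (u \o p) by exact: (measurable_comp mE).
have mup1 : measurable_fun D (fun x => u (p x)) by exact: mup.
(* The shift makes the function nonnegative, hence an increasing limit of simple functions, all
   bounded by [2 * M]; the constant is subtracted again at the end. *)
pose w y := u y + M.
have mw : measurable_fun E w by apply: measurable_funD => //; exact: measurable_cst.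
have w0 y : E y -> (0 <= (w y)%:E)%E.
  by move=> Ey; rewrite lee_fin -lerBlDr sub0r; have /ler_normlP[] := uM _ Ey; lra.
have mwE : measurable_fun E (EFin \o w) by exact/measurable_EFinP.
pose s := nnsfun_approx mE mwE.
have s_w y : E y -> s ^~ y @ \oo --> w y.
  move=> Ey; have := cvg_nnsfun_approx mE mwE w0 Ey.
  by move=> /fine_cvg; apply: cvg_trans.
have s0 k y : 0 <= s k y by [].
have sle k y : E y -> s k y <= w y.
  move=> Ey; have s_nd : nondecreasing_seq (s ^~ y).
    by move=> i j ij; have := nd_nnsfun_approx mE mwE ij => /lefP; exact.
  have <- : lim (s ^~ y @ \oo) = w y by apply/cvg_lim => //; exact: s_w.
  by apply: nondecreasing_cvgn_le => //; apply/cvg_ex; exists (w y); exact: s_w.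
have sM k y : E y -> `|s k y| <= 2 * M.
  move=> Ey; rewrite ger0_norm// (le_trans (sle _ _ Ey))// /w.
  by have := le_trans (ler_norm _) (uM _ Ey); lra.
have ms k : measurable_fun E (s k).
  exact: measurable_funTS.
have msp k : measurable_fun D (fun x => s k (p x)).
  by apply: (measurable_comp mE) => //.
(* Stated for an arbitrary measure space because it is used on both sides: over [D] along [p], and
   over [E] along the identity. *)
have lim_w d (Z : measurableType d) (l : {measure set Z -> \bar R}) (C : set Z)
    (q : Z -> Y) (c : Z -> R) : measurable C -> (forall z, C z -> E (q z)) ->
    (forall k, measurable_fun C (fun z => s k (q z))) ->
    l.-integrable C (EFin \o c) ->
    (\int[l]_(z in C) (s k (q z) * c z)%:E)%E @[k --> \oo] -->
    (\int[l]_(z in C) (w (q z) * c z)%:E)%E.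
  move=> mC qE msq ic.
  have mc : measurable_fun C c by apply/measurable_EFinP; exact: measurable_int ic.
  apply: (@dominated_cvg _ _ _ l C mC (fun k z => (s k (q z) * c z)%:E)
    (fun z => (w (q z) * c z)%:E) (fun z => ((2 * M) * `|c z|)%:E)) => //.
  - by move=> k; apply/measurable_EFinP; exact: measurable_funM.
  - move=> z Cz; apply: cvg_EFin; first exact: nearW.
    apply: cvgMl; exact/s_w/qE.
  - have := integrableZl mC (2 * M) (integrable_norm ic).
    by congr (_.-integrable _ _).
  - by move=> k z Cz; rewrite lee_fin normrM ler_wpM2r// sM//; exact: qE.
have ww : (\int[m]_(x in D) (w (p x) * a x)%:E =
           \int[n]_(y in E) (w y * b y)%:E)%E.
  apply: (cvg_unique _ (lim_w _ _ m D p a mD pE msp ia)); first exact: ereal_hausdorff.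
  move=> A nA.
  have := (lim_w _ _ n E idfun b mE (fun y Ey => Ey) ms ib A nA).
  have -> // : (fun k => \int[m]_(x in D) (s k (p x) * a x)%:E)%E =
    (fun k => \int[n]_(y in E) (s k y * b y)%:E)%E.
  by apply/funext => k; exact: transfer_nnsfun.
(* This is hypothesis [ab] for the full set, scaled by [M]. *)
have MM : (\int[m]_(x in D) (M * a x)%:E = \int[n]_(y in E) (M * b y)%:E)%E.
  under eq_integral do rewrite EFinM.
  under [RHS]eq_integral do rewrite EFinM.
  rewrite (integralZl mD ia) (integralZl mE ib).
  by have := ab measurableT; rewrite preimage_setT !setTI => ->.
have wE y c : ((u y * c)%:E = (w y * c)%:E - (M * c)%:E)%E.
  by rewrite -EFinB /w mulrDl addrK.
have wM y : E y -> `|w y| <= 2 * M.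
  move=> Ey; rewrite ger0_norm -?lee_fin ?w0// lee_fin.
  by have := le_trans (ler_norm _) (uM _ Ey); rewrite /w; lra.
under eq_integral do rewrite wE.
under [RHS]eq_integral do rewrite wE.
rewrite integralB//; last 2 first.
- apply: (@integrable_bounded_mul _ _ _ _ _ (w \o p) _ (2 * M)) => //.
  + exact: measurable_comp mw mp.
  + by move=> x Dx; apply: wM; exact: pE.
- exact (integrableZl mD M ia).
rewrite integralB//; last 2 first.
- exact: (@integrable_bounded_mul _ _ _ _ _ _ _ (2 * M)).
- exact (integrableZl mE M ib).
by rewrite ww MM.
Qed.

End transfer.

(** * Finiteness of the Lipschitz constant and of the sup norm *)

Lemma IsetP (R : realType) (x : R) : Iset x <-> `|x| <= 2^-1.
Proof. by rewrite /Iset /= in_itv/= ler_norml. Qed.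

Lemma Iset0 (R : realType) : @Iset R 0.
Proof. by apply/IsetP; rewrite normr0 invr_ge0. Qed.

Lemma Sigma0 (R : realType) : @Sigma R (0, 0).
Proof. by split; exact: Iset0. Qed.

Lemma lebesgue_Iset (R : realType) : (@lebesgue_measure R Iset = 1)%E.
Proof.
rewrite /Iset lebesgue_measure_itv/= lte_fin ifT; last by lra.
by rewrite -EFinB; congr EFin; lra.
Qed.

(** Turns the extended-real supremum into a real number that is itself a Lipschitz constant, so that
    later estimates run in [R]. *)
Lemma Lconst_lip (R : realType) (f : R * R -> R) : is_lipschitz f ->
  exists l : R, [/\ Lconst f = l%:E, 0 <= l & lip_with l f].
Proof.
move=> [l0 lf].
(* A point of [Sigma] other than the origin: the supremum then runs over a nonempty set and is
   nonnegative instead of [-oo]. *)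
pose e : R * R := (2^-1, 0).
have Se : Sigma e by split; [apply/IsetP; rewrite ger0_norm ?invr_ge0|exact: Iset0].
have e0 : (0, 0) <> e :> R * R by case; lra.
have d_gt0 (p q : R * R) : p <> q -> 0 < supdist p q.
  move=> pq; rewrite lt_def supdist_ge0 andbT; apply/eqP => d0; apply: pq.
  have := lexx (supdist p q); rewrite {2}d0 /supdist ge_max !normr_le0 !subr_eq0.
  by case: p q {d0} => [p1 p2] [q1 q2] /= /andP[/eqP -> /eqP ->].
have Lle : (Lconst f <= l0%:E)%E.
  apply: ge_ereal_sup => _ /= [[p q] [/= Sp Sq pq] <-].
  by rewrite lee_fin ler_pdivrMr ?d_gt0// lf.
have Lge p q : Sigma p -> Sigma q -> p <> q ->
    ((`|f p - f q| / supdist p q)%:E <= Lconst f)%E.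
  by move=> Sp Sq pq; apply: ereal_sup_ubound; exists (p, q).
have L0 : (0 <= Lconst f)%E.
  apply: le_trans (Lge _ _ (Sigma0 R) Se e0).
  by rewrite lee_fin divr_ge0// supdist_ge0.
have Lfin : Lconst f \is a fin_num.
  by rewrite ge0_fin_numE// (le_lt_trans Lle)// ltry.
exists (fine (Lconst f)); split; [by rewrite fineK|exact: fine_ge0|].
move=> p q Sp Sq; have [->|/eqP pq] := eqVneq p q.
  by rewrite subrr normr0 mulr_ge0 ?fine_ge0// supdist_ge0.
by rewrite -ler_pdivrMr ?d_gt0// -lee_fin fineK//; exact: Lge.
Qed.

Lemma supdist0_le1 (R : realType) (p : R * R) : Sigma p -> supdist p (0, 0) <= 1.
Proof.
by move=> [/IsetP p1 /IsetP p2]; rewrite /supdist/= !subr0 ge_max; lra.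
Qed.

Lemma lipschitz_sup_norm (R : realType) (f : R * R -> R) : is_lipschitz f ->
  exists M : R, [/\ ereal_sup [set `|f p|%:E | p in Sigma] = M%:E, 0 <= M
    & forall p, Sigma p -> `|f p| <= M].
Proof.
move=> /Lconst_lip[l [_ l0 lf]].
set S := ereal_sup _.
have Sge p : Sigma p -> (`|f p|%:E <= S)%E.
  by move=> Sp; apply: ereal_sup_ubound; exists p.
have S0 : (0 <= S)%E by apply: le_trans (Sge _ (Sigma0 R)); rewrite lee_fin.
have Sfin : S \is a fin_num.
  rewrite ge0_fin_numE// (@le_lt_trans _ _ (`|f (0, 0)| + l)%:E)// ?ltry//.
  apply: ge_ereal_sup => _ /= [p Sp <-]; rewrite lee_fin -lerBlDl.
  rewrite (le_trans (lerB_dist _ _))// (le_trans (lf _ _ Sp (Sigma0 R)))//.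
  by rewrite ler_piMr// supdist0_le1.
exists (fine S); split; [by rewrite fineK|exact: fine_ge0|].
by move=> p Sp; rewrite -lee_fin fineK//; exact: Sge.
Qed.

(** * Iterates of a self-map, and integrals over a set of mass one *)

Lemma iter_stable (X : Type) (D : set X) (h : X -> X) n x :
  (forall x, D x -> D (h x)) -> D x -> D (iter n h x).
Proof. by move=> hD Dx; elim: n => //= n; exact: hD. Qed.

Lemma measurable_iter d (X : measurableType d) (D : set X) (h : X -> X) n :
  measurable D -> (forall x, D x -> D (h x)) -> measurable_fun D h ->
  measurable_fun D (iter n h).
Proof.
move=> mD hD mh; elim: n => [|n IH]; first exact: (@measurable_id _ _ D).
rewrite [iter _ _](_ : _ = h \o iter n h)//.
by apply: (measurable_comp mD) => // _ /= [x Dx <-]; exact: iter_stable.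
Qed.

Section Rintegral_probability.
Context d (X : measurableType d) (R : realType) (m : {measure set X -> \bar R}).
Variable D : set X.
Hypotheses (mD : measurable D) (D1 : m D = 1%E).

Lemma Rintegral_dist (u v : X -> R) (c : R) : m.-integrable D (EFin \o u) ->
  m.-integrable D (EFin \o v) -> (forall x, D x -> `|u x - v x| <= c) ->
  `|\int[m]_(x in D) u x - \int[m]_(x in D) v x| <= c.
Proof.
move=> iu iv uvc; rewrite -RintegralB//.
have iuv : m.-integrable D (EFin \o (fun x => u x - v x)).
  exact (integrableB mD iu iv).
have ic : m.-integrable D (EFin \o cst c).
  apply: (@bounded_integrable _ _ _ _ _ _ `|c|) => //; first by rewrite D1 ltry.
apply: (le_trans (le_normr_Rintegral mD iuv)).
rewrite -[leRHS]mulr1 -[X in _ <= c * X]/(fine 1%E) -D1 -(Rintegral_cst m mD c).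
by apply: le_Rintegral => //; exact: integrable_norm.
Qed.

Lemma Rintegral_shift (u : X -> R) (c : R) : m.-integrable D (EFin \o u) ->
  \int[m]_(x in D) (u x - c) = \int[m]_(x in D) u x - c.
Proof.
move=> iu.
have ic : m.-integrable D (EFin \o cst c).
  apply: (@bounded_integrable _ _ _ _ _ _ `|c|) => //; first by rewrite D1 ltry.
by rewrite (RintegralB mD iu ic) (Rintegral_cst m mD c) D1/= mulr1.
Qed.

End Rintegral_probability.

(** [Iset] has length one, so the integral of [b] is its mean, and every value lies within [V] of
    it. The sup norm is thus at most [N + V], and the variation adds another [V]. *)
Lemma BVnorm_density (R : realType) (b : R -> R) (N V : R) :
  bounded_variation (- 2^-1) 2^-1 b ->
  (total_variation (- 2^-1) 2^-1 b <= V%:E)%E ->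
  `|\int[@lebesgue_measure R]_(x in Iset) b x| <= N ->
  (@lebesgue_measure R).-integrable Iset (EFin \o b) /\
  (BVnorm b <= (N + 2 * V)%:E)%E.
Proof.
move=> bvb bV bN.
have osc x y : Iset x -> Iset y -> `|b x - b y| <= V.
  wlog xy : x y / x <= y.
    move=> H Ix Iy; have [xy|/ltW yx] := leP x y; first exact: H.
    by rewrite distrC; exact: H.
  rewrite /Iset/= !in_itv/= => /andP[ax xb] /andP[ay yb].
  rewrite distrC -lee_fin (le_trans _ bV)//.
  (* The increment is controlled by the variation on the middle piece of the interval cut at [x] and
     [y]; the outer pieces are nonnegative. *)
  rewrite (total_variationD _ ax xb) (total_variationD _ xy yb).
  apply: (le_trans (total_variation_ge _ xy)).
  by rewrite addeCA leeDl// adde_ge0// total_variation_ge0.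
have mb : measurable_fun Iset b by exact: bounded_variation_measurable.
have mI := @measurable_Iset R.
have I1 := @lebesgue_Iset R.
have ib : (@lebesgue_measure R).-integrable Iset (EFin \o b).
  apply: (@bounded_integrable _ _ _ _ _ _ (`|b 0| + V)) => //.
    by rewrite [ltLHS]I1 ltry.
  move=> x Ix; rewrite -lerBlDl (le_trans (lerB_dist _ _))//.
  exact: osc Ix (@Iset0 R).
have bNV x : Iset x -> `|b x| <= N + V.
  move=> Ix; rewrite -lerBlDl.
  have ic : (@lebesgue_measure R).-integrable Iset (EFin \o cst (b x)).
    apply: (@bounded_integrable _ _ _ _ _ _ `|b x|) => //.
      by rewrite [ltLHS]I1 ltry.
  have := @Rintegral_dist _ _ R (@lebesgue_measure R) _ mI I1 _ _ V ic ib
    (fun y Iy => osc x y Ix Iy).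
  rewrite [X in `|X - _| <= _ -> _](Rintegral_cst (@lebesgue_measure R) mI (b x)).
  rewrite [X in fine X](I1)/= mulr1.
  by have := lerB_dist (b x) (\int[lebesgue_measure]_(x0 in Iset) b x0); lra.
split => //; rewrite /BVnorm mulrDl mul1r addrA EFinD leeD//.
by apply: ge_ereal_sup => _ /= [x Ix <-]; rewrite lee_fin bNV.
Qed.

Lemma EFin_Rintegral d (X : measurableType d) (R : realType)
    (m : {measure set X -> \bar R}) (D : set X) (u : X -> R) :
  measurable D -> m.-integrable D (EFin \o u) ->
  (\int[m]_(x in D) (u x)%:E = (\int[m]_(x in D) u x)%:E)%E.
Proof. by move=> mD iu; rewrite fineK//; exact: integrable_fin_num iu. Qed.

Lemma BVnorm_ge0 (R : realType) (b : R -> R) : (0 <= BVnorm b)%E.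
Proof.
rewrite /BVnorm adde_ge0//; last by apply: total_variation_ge0; lra.
apply: (@le_trans _ _ `|b 0|%:E); first by rewrite lee_fin.
by apply: ereal_sup_ubound; exists 0 => //; exact: Iset0.
Qed.

(** * The skew product: invariance, marginal, fibre contraction, correlation bound *)

Section skew_product.
Context (R : realType) (T : R -> R) (G : R -> R -> R).
Variable mu : probability (R * R)%type R.
Let F : R * R -> R * R := fun z => (T z.1, G z.1 z.2).
Let leb := @lebesgue_measure R.
Let mux := pushforward mu fst.
Hypothesis mF : measurable_fun Sigma F.
Hypothesis FS : forall z, Sigma z -> Sigma (F z).
Hypothesis muS : mu Sigma = 1%E.
Hypothesis muF : forall A, measurable A -> mu (F @^-1` A `&` Sigma) = mu A.

Let mS := @measurable_Sigma R.
Let mI := @measurable_Iset R.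
Let muSfin : (mu Sigma < +oo)%E. Proof. by rewrite muS ltry. Qed.

Let TI x : Iset x -> Iset (T x).
Proof. by move=> Ix; have [] := FS (conj Ix (@Iset0 R) : Sigma (x, 0)). Qed.

Let iter_fst n z : (iter n F z).1 = iter n T z.1.
Proof. by elim: n => //= n ->. Qed.

Let measurable_section : measurable_fun Iset (fun x : R => (x, 0 : R)).
Proof.
exact/measurable_funTS/pair2_measurable.
Qed.

Let measurable_comp_section (Z : R * R -> R) :
  measurable_fun Sigma Z -> measurable_fun Iset (fun x => Z (x, 0)).
Proof.
move=> mZ; apply: (measurable_comp mS _ mZ measurable_section).
by move=> _ /= [x Ix <-]; split => //; exact: Iset0.
Qed.

(** [T] is the first coordinate of [F] along the section of height zero. *)
Let mT : measurable_fun Iset T.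
Proof.
apply: (@measurable_comp_section (fst \o F)).
by apply: (measurable_comp measurableT _ _ mF) => //; exact: measurable_fst.
Qed.

Let mFn n : measurable_fun Sigma (iter n F).
Proof. exact: measurable_iter. Qed.

Let mTn n : measurable_fun Iset (iter n T).
Proof. exact: measurable_iter. Qed.

Let measurable_comp_iterF (u : R * R -> R) n : measurable_fun Sigma u ->
  measurable_fun Sigma (fun z => u (iter n F z)).
Proof.
move=> mu_; apply: (measurable_comp mS _ mu_ (mFn n)).
by move=> _ /= [z Sz <-]; exact: iter_stable.
Qed.

Let measurable_comp_iterT (u : R -> R) n : measurable_fun Iset u ->
  measurable_fun Iset (fun x => u (iter n T x)).
Proof.
move=> mu_; apply: (measurable_comp mI _ mu_ (mTn n)).
by move=> _ /= [z Sz <-]; exact: iter_stable.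
Qed.

Let measurable_comp_fst (u : R -> R) : measurable_fun Iset u ->
  measurable_fun Sigma (fun z => u z.1).
Proof.
move=> mu_; apply: (measurable_comp mI _ mu_); first by move=> _ /= [z [Iz _] <-].
exact: (measurable_funTS measurable_fst).
Qed.

Let integral_invariant (u : R * R -> R) (M : R) n : measurable_fun Sigma u ->
  (forall z, Sigma z -> `|u z| <= M) ->
  \int[mu]_(z in Sigma) u (iter n F z) = \int[mu]_(z in Sigma) u z.
Proof.
move=> mu_ uM; elim: n => //= n <-.
have i1 : mu.-integrable Sigma (EFin \o cst (1 : R)).
  exact: (@bounded_integrable _ _ _ _ _ _ `|1|).
have inv1 A : measurable A ->
    (\int[mu]_(x in F @^-1` A `&` Sigma) (cst 1 x)%:E =
     \int[mu]_(y in A `&` Sigma) (cst 1 y)%:E)%E.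
  have e B : measurable B -> (\int[mu]_(x in B) (cst 1 x)%:E = mu B)%E.
    by move=> mB; have := integral_cst mu mB 1%E; rewrite mul1e.
  move=> mA; rewrite !e; last 2 first.
  - exact: measurableI.
  - by rewrite setIC; exact: mF.
  (* Invariance is applied to the trace of [A] on [Sigma]; since [F] preserves [Sigma], both traces
     have the same preimage there. *)
  have /muF <- : measurable (A `&` Sigma) by exact: measurableI.
  congr (mu _); apply/seteqP; split => z /=; last by move=> [[]].
  by move=> [Az Sz]; split => //; split => //; exact: FS.
have := @transfer_integral _ _ _ _ R mu mu Sigma Sigma F _ _ mS mS mF i1 i1 inv1
  (fun z => u (iter n F z)) M.
rewrite /Rintegral => tr; congr fine.
transitivity (\int[mu]_(x in Sigma) (u (iter n F (F x)) * cst 1 x)%:E)%E.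
  by apply: eq_integral => z _; rewrite -iterSr mulr1.
rewrite tr.
- by apply: eq_integral => z _; rewrite mulr1.
- by move=> _ /= [z Sz <-]; exact: FS.
- exact: measurable_comp_iterF.
- by move=> z Sz; apply: uM; exact: iter_stable.
Qed.

(** The marginal lives on the whole line while [u] is controlled on [Iset] only, hence the extension
    by zero; the complement of [Sigma] is [mu]-null. *)
Let integral_marginal (u : R -> R) (M : R) : measurable_fun Iset u ->
  (forall x, Iset x -> `|u x| <= M) ->
  (\int[mux]_x ((u \_ Iset) x)%:E = \int[mu]_(z in Sigma) (u z.1)%:E)%E.
Proof.
move=> mu_ uM.
have mw := (measurable_restrictT u mI).1 mu_.
have iw : mu.-integrable setT ((EFin \o (u \_ Iset)) \o fst).
  apply: (@bounded_integrable _ _ _ _ _ ((u \_ Iset) \o fst) `|M|) => //.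
  - by rewrite (le_lt_trans (probability_le1 mu measurableT))// ltry.
  - exact: measurableT_comp.
  - move=> z _ /=; rewrite patchE; case: ifPn => [/set_mem Iz|_]; last by rewrite normr0.
    by rewrite (le_trans (uM _ Iz))// ler_norm.
rewrite (@integral_pushforward _ _ _ _ _ _ measurable_fst mu setT
  (EFin \o (u \_ Iset)))//; last exact/measurable_EFinP.
rewrite preimage_setT (@negligible_integral _ _ _ _ setT (~` Sigma))//.
- rewrite setTD setCK; apply: eq_integral => z /set_mem [Iz _] /=.
  by rewrite patchE mem_set.
- exact: measurableC.
- by have := probability_setC mu mS; rewrite muS subee.
Qed.

Variables C lam lam0 : R.
Hypothesis C0 : 0 <= C.
Hypothesis decay : forall (g f : R -> R) (n : nat),
  measurable_fun Iset g -> leb.-integrable Iset (EFin \o g) ->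
  bounded_variation (- 2^-1) 2^-1 f ->
  (`| (\int[leb]_(x in Iset) (g (iter n T x) * f x)%:E)
      - (\int[mux]_x (g x)%:E) * (\int[leb]_(x in Iset) (f x)%:E) |
   <= C%:E * (\int[leb]_(x in Iset) `|g x|%:E) * BVnorm f
      * (expR (- lam * n%:R))%:E)%E.
Hypothesis lam0_ge0 : 0 <= lam0.
Hypothesis contraction : forall x y1 y2, Iset x -> Iset y1 -> Iset y2 ->
  `|G x y1 - G x y2| <= lam0 * `|y1 - y2|.

(** Both orbits have the same first coordinates, so only the heights differ; each step contracts
    them, starting from a gap of at most one half. *)
Let supdist_fiber k z : Sigma z ->
  supdist (iter k F z) (iter k F (z.1, 0)) <= lam0 ^+ k.
Proof.
move=> Sz; have Sz0 : Sigma (z.1, 0) by split; [exact: Sz.1|exact: Iset0].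
rewrite /supdist !iter_fst/= subrr normr0 ge_max exprn_ge0//=.
have : `|(iter k F z).2 - (iter k F (z.1, 0)).2| <= lam0 ^+ k * `|z.2|.
  elim: k => [|k IH] /=; first by rewrite subr0 expr0 mul1r.
  rewrite !iter_fst/= exprS -mulrA (le_trans (contraction _ _ _)) ?ler_wpM2l//.
  - by rewrite -iter_fst; exact: (iter_stable _ FS Sz).1.
  - exact: (iter_stable _ FS Sz).2.
  - exact: (iter_stable _ FS Sz0).2.
move=> /le_trans; apply; rewrite ler_piMr ?exprn_ge0//.
by have /IsetP := Sz.2; lra.
Qed.

(** The fibre error [L * M * lam0 ^+ k] occurs twice: when [h] replaces [g] after [k] steps inside
    the correlation, and again in the product of the means. The last term is the base decay over [j]
    steps. *)
Lemma centered_correlation_bound (g f : R * R -> R) (fb : R -> R) (L M V : R) k j :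
  0 <= L -> lip_with L g -> (forall z, Sigma z -> `|g z| <= L) ->
  0 <= M -> measurable_fun Sigma f -> (forall z, Sigma z -> `|f z| <= M) ->
  (forall A, measurable A ->
    (\int[mu]_(z in fst @^-1` A `&` Sigma) (f z)%:E
     = \int[leb]_(x in A `&` Iset) (fb x)%:E)%E) ->
  bounded_variation (- 2^-1) 2^-1 fb ->
  0 <= V -> (total_variation (- 2^-1) 2^-1 fb <= V%:E)%E ->
  `| \int[mu]_(z in Sigma) (g (iter (k + j) F z) * f z)
     - \int[mu]_(z in Sigma) f z * \int[mu]_(z in Sigma) g z |
  <= 2 * (L * M * lam0 ^+ k) + C * L * (M + 2 * V) * expR (- lam * j%:R).
Proof.
move=> L0 gL gM M0 mf fM ffb bvfb V0 fbV.
have mg : measurable_fun Sigma g by apply: lipschitz_measurable; exists L.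
pose h x := g (iter k F (x, 0)).
have mh : measurable_fun Iset h.
  apply: (measurable_comp_section (Z := fun z => g (iter k F z))).
  exact: measurable_comp_iterF.
have SI0 x : Iset x -> Sigma (x, 0) by move=> Ix; split => //; exact: Iset0.
have hL x : Iset x -> `|h x| <= L.
  by move=> Ix; apply: gM; apply: iter_stable => //; exact: SI0.
have gh z : Sigma z -> `|g (iter k F z) - h z.1| <= L * lam0 ^+ k.
  move=> Sz; apply: le_trans (gL _ _ _ _) _; [exact: iter_stable| |].
    by apply: iter_stable => //; apply: SI0; exact: Sz.1.
  by rewrite ler_wpM2l// supdist_fiber.
have iS (u : R * R -> R) N : measurable_fun Sigma u ->
    (forall z, Sigma z -> `|u z| <= N) ->
    mu.-integrable Sigma (EFin \o u) by exact: bounded_integrable.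
have if_ := iS _ _ mf fM.
have fE : (\int[mu]_(z in Sigma) (f z)%:E = \int[leb]_(x in Iset) (fb x)%:E)%E.
  by have := ffb _ measurableT; rewrite preimage_setT !setTI.
have fRE : \int[mu]_(z in Sigma) f z = \int[leb]_(x in Iset) fb x.
  by rewrite /Rintegral fE.
have int_f_le : `|\int[mu]_(z in Sigma) f z| <= M.
  have i0 : mu.-integrable Sigma (EFin \o (fun=> 0 : R)).
    by apply: (iS _ 0) => // z _; rewrite normr0.
  have := @Rintegral_dist _ _ _ mu _ mS muS f (fun=> 0) M if_ i0.
  rewrite (Rintegral_cst mu mS 0) mul0r subr0; apply => z Sz.
  by rewrite subr0 fM.
have [ifb BVfb] : leb.-integrable Iset (EFin \o fb) /\
    (BVnorm fb <= (M + 2 * V)%:E)%E.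
  by apply: BVnorm_density => //; rewrite -fRE.
(* The fibre estimate [gh] is used at the point [iter j F z], whose base coordinate is
   [iter j T z.1]. *)
have stepA : `|\int[mu]_(z in Sigma) (g (iter (k + j) F z) * f z)
    - \int[mu]_(z in Sigma) (h (iter j T z.1) * f z)| <= L * M * lam0 ^+ k.
  apply: Rintegral_dist => //.
  - apply: (@integrable_bounded_mul _ _ _ _ _ _ _ L) => //.
      exact: measurable_comp_iterF.
    by move=> z Sz; apply: gM; exact: iter_stable.
  - apply: (@integrable_bounded_mul _ _ _ _ _ _ _ L) => //.
      exact: (measurable_comp_fst (measurable_comp_iterT j mh)).
    by move=> z [Iz _]; apply: hL; exact: iter_stable.
  - move=> z Sz; rewrite -mulrBl normrM mulrAC ler_pM// ?fM// iterD -iter_fst.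
    by apply: gh; exact: iter_stable.
have stepB : \int[mu]_(z in Sigma) (h (iter j T z.1) * f z) =
    \int[leb]_(x in Iset) (h (iter j T x) * fb x).
  congr fine; apply: (@transfer_integral _ _ _ _ R mu leb Sigma Iset fst f fb
    mS mI _ if_ ifb ffb
    (fun x => h (iter j T x)) L).
  - exact: measurable_funTS.
  - by move=> _ /= [z [Iz _] <-].
  - exact: measurable_comp_iterT.
  - by move=> x Ix; apply: hL; exact: iter_stable.
(* Invariance replaces the mean of [g] by that of [g] after [k] steps, which [gh] compares with
   [h]. *)
have stepD : `|\int[mu]_(z in Sigma) h z.1 - \int[mu]_(z in Sigma) g z| <= L * lam0 ^+ k.
  rewrite -(integral_invariant k mg gM) distrC; apply: Rintegral_dist => //.
  - apply: (iS _ L); first exact: measurable_comp_iterF.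
    by move=> z Sz; apply: gM; exact: iter_stable.
  - apply: (iS _ L); first exact: measurable_comp_fst.
    by move=> z [Iz _]; exact: hL.
have ihfb : leb.-integrable Iset (EFin \o (fun x => h (iter j T x) * fb x)).
  apply: (@integrable_bounded_mul _ _ _ _ _ _ _ L) => //.
    exact: measurable_comp_iterT.
  by move=> x Ix; apply: hL; exact: iter_stable.
have ihS : mu.-integrable Sigma (EFin \o (fun z => h z.1)).
  apply: (iS _ L); first exact: measurable_comp_fst.
  by move=> z [Iz _]; exact: hL.
have stepC : `|\int[leb]_(x in Iset) (h (iter j T x) * fb x)
    - \int[mu]_(z in Sigma) h z.1 * \int[leb]_(x in Iset) fb x|
    <= C * L * (M + 2 * V) * expR (- lam * j%:R).
  (* The marginal integral in [decay] ranges over the whole line, so [h] is cut off outside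
     [Iset]. *)
  pose w := h \_ Iset.
  have wE x : Iset x -> w x = h x by move=> Ix; rewrite /w patchE mem_set.
  have mw : measurable_fun Iset w.
    exact: (measurable_funTS ((measurable_restrictT h mI).1 mh)).
  have iw : leb.-integrable Iset (EFin \o w).
    apply: (@bounded_integrable _ _ _ _ _ _ L) => //.
      by rewrite [ltLHS](@lebesgue_Iset R) ltry.
    by move=> x Ix; rewrite wE// hL.
  have := decay j mw iw bvfb.
  rewrite (integral_marginal mh hL) (EFin_Rintegral mS ihS).
  rewrite (EFin_Rintegral (m := leb) mI ifb).
  have -> : (\int[leb]_(x in Iset) (w (iter j T x) * fb x)%:E =
      \int[leb]_(x in Iset) (h (iter j T x) * fb x)%:E)%E.
    apply: eq_integral => x /set_mem Ix.
    by rewrite wE//; exact: iter_stable.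
  rewrite (EFin_Rintegral (m := leb) mI ihfb) -EFinM -EFinB abse_EFin => /le_trans le_b.
  rewrite -lee_fin; apply: le_b.
  rewrite EFinM lee_wpmul2r ?lee_fin ?expR_ge0//.
  rewrite EFinM lee_pmul//.
  - by rewrite mule_ge0// integral_ge0.
  - exact: BVnorm_ge0.
  rewrite EFinM lee_wpmul2l//.
  (* As [Iset] has length one, the sup bound [L] also bounds the L1 norm. *)
  have -> : (L%:E = \int[leb]_(x in Iset) cst L%:E x)%E.
    by rewrite (integral_cst leb mI) [X in (_ * X)%E](@lebesgue_Iset R) mule1.
  apply: ge0_le_integral => //.
  - by apply/measurable_EFinP; exact: measurableT_comp.
  - by move=> x Ix; rewrite lee_fin wE// hL.
rewrite -fRE in stepC; rewrite stepB in stepA.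
set a := \int[mu]_(z in Sigma) (g _ * _) in stepA *.
set b := \int[leb]_(x in Iset) _ in stepA stepC.
set F0 := \int[mu]_(z in Sigma) f z in stepC int_f_le *.
set H := \int[mu]_(z in Sigma) h z.1 in stepC stepD.
set G0 := \int[mu]_(z in Sigma) g z in stepD *.
have stepE : `|H * F0 - F0 * G0| <= L * M * lam0 ^+ k.
  by rewrite [F0 * _]mulrC -mulrBl normrM mulrAC ler_pM.
rewrite [a - _](_ : _ = (a - b) + (b - H * F0) + (H * F0 - F0 * G0)); last by lra.
rewrite (le_trans (ler_normD _ _))//.
by have := ler_normD (a - b) (b - H * F0); lra.
Qed.

End skew_product.

(** * Splitting the time in halves, and the final constants *)

Lemma expR_half_le (R : realType) (a : R) (n m : nat) : 0 <= a ->
  (n./2 <= m)%N -> expR (- a * m%:R) <= expR (a / 2) * expR (- (a / 2) * n%:R).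
Proof.
move=> a0 nm; rewrite -expRD ler_expR.
(* The extra 1 covers odd [n]; it is what the factor [expR (a / 2)] pays for. *)
have : n%:R <= 1 + 2 * m%:R :> R by rewrite -natrM -[1]/(1%:R) -natrD ler_nat; lia.
by move/(ler_wpM2l a0); lra.
Qed.

Lemma half_leq_subn (n : nat) : (n./2 <= n - n./2)%N.
Proof. lia. Qed.

Theorem theorem4p7 (R : realType) (T : R -> R) (G : R -> R -> R)
  (mu : probability (R * R)%type R) :
  let F : R * R -> R * R := fun z => (T z.1, G z.1 z.2) in
  let leb := (@lebesgue_measure R) in
  let mux := pushforward mu fst in
  (* F is a Borel self-map of Sigma *)
  measurable_fun Sigma F ->
  (forall z, Sigma z -> Sigma (F z)) ->
  (* mu is a probability measure on Sigma, F-invariant *)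
  mu Sigma = 1%E ->
  (forall A, measurable A -> mu (F @^-1` A `&` Sigma) = mu A) ->
  (* (1) exponential decay for T w.r.t. L^1 and BV observables *)
  (exists C lam : R, 0 < C /\ 0 < lam /\
     forall (g f : R -> R) (n : nat),
       measurable_fun Iset g -> leb.-integrable Iset (EFin \o g) ->
       bounded_variation (- 2^-1) 2^-1 f ->
       (`| (\int[leb]_(x in Iset) (g (iter n T x) * f x)%:E)
           - (\int[mux]_x (g x)%:E) * (\int[leb]_(x in Iset) (f x)%:E) |
        <= C%:E * (\int[leb]_(x in Iset) `|g x|%:E) * BVnorm f
           * (expR (- lam * n%:R))%:E)%E) ->
  (forall x, Iset x -> finite_set (T @^-1` [set x] `&` Iset)) ->
  (* (2) uniform contraction of the fibre maps *)
  (exists lam0 : R, lam0 < 1 /\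
     forall x y1 y2, Iset x -> Iset y1 -> Iset y2 ->
       `|G x y1 - G x y2| <= lam0 * `|y1 - y2|) ->
  (* (3) regularity of the projected measures f mu *)
  (exists K : R, forall (l : R) (f : R * R -> R), lip_with l f ->
     exists fb : R -> R,
       (forall A, measurable A ->
          (\int[mu]_(z in fst @^-1` A `&` Sigma) (f z)%:E
           = \int[leb]_(x in A `&` Iset) (fb x)%:E)%E) /\
       bounded_variation (- 2^-1) 2^-1 fb /\
       (total_variation (- 2^-1) 2^-1 fb <= (K * l)%:E)%E) ->
  (* conclusion: exponential decay of correlations for (F, mu) *)
  exists C' rho : R, 0 < C' /\ 0 < rho /\
    forall (g f : R * R -> R) (n : nat),
      is_lipschitz g -> is_lipschitz f -> (forall z, Sigma z -> 0 <= f z) ->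
      (`| (\int[mu]_(z in Sigma) (g (iter n F z) * f z)%:E)
          - (\int[mu]_(z in Sigma) (f z)%:E) * (\int[mu]_(z in Sigma) (g z)%:E) |
       <= C'%:E * Lconst g * lipnorm f * (expR (- rho * n%:R))%:E)%E.
Proof.
move=> F leb mux mF FS muS muF [C [lam [C0 [lam_gt0 decay]]]] _ [lam1 [lam1_lt1 contr1]].
move=> [K regular].
(* The given factor may be zero or negative; the maximum keeps it below 1 and makes its logarithm
   meaningful. *)
pose lam0 := Num.max lam1 2^-1.
have lam0_gt0 : 0 < lam0 by rewrite lt_max invr_gt0 ltr0n orbT.
have lam0_lt1 : lam0 < 1 by rewrite gt_max lam1_lt1/=; lra.
have contr x y1 y2 : Iset x -> Iset y1 -> Iset y2 ->
    `|G x y1 - G x y2| <= lam0 * `|y1 - y2|.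
  move=> Ix Iy1 Iy2; rewrite (le_trans (contr1 _ _ _ Ix Iy1 Iy2))//.
  by rewrite ler_wpM2r// le_max lexx.
(* The slower of the base rate and the fibre rate; half of it is the final rate, as each mechanism
   acts for half of the time. *)
pose a := Num.min lam (- ln lam0).
have a_gt0 : 0 < a by rewrite lt_min lam_gt0 oppr_gt0 ln_lt0 ?lam0_gt0.
(* The 2 counts the two fibre errors, the next summand comes from the BV norm of the density, and
   the exponential absorbs the rounding of [n / 2]. *)
pose C' := expR (a / 2) * (2 + C * (1 + 2 * `|K|)).
have C'_gt0 : 0 < C'.
  rewrite mulr_gt0 ?expR_gt0// ltr_wpDr// mulr_ge0 ?ltW//.
exists C', (a / 2); split => //; split; first by rewrite divr_gt0.
move=> g f n lipg lipf f0.
have [L [gLE L0 gL]] := Lconst_lip lipg.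
have [l [flE l0 fl]] := Lconst_lip lipf.
have [M [fME M0 fM]] := lipschitz_sup_norm lipf.
have [N [_ _ gN]] := lipschitz_sup_norm lipg.
have mS := @measurable_Sigma R.
have mf := lipschitz_measurable lipf.
have mg := lipschitz_measurable lipg.
have [fb [ffb [bvfb fbK]]] := regular _ _ fl.
have fbV : (total_variation (- 2^-1) 2^-1 fb <= (`|K| * l)%:E)%E.
  by rewrite (le_trans fbK)// lee_fin ler_wpM2r// ler_norm.
have muSfin : (mu Sigma < +oo)%E by rewrite muS ltry.
have iS (u : R * R -> R) (B : R) : measurable_fun Sigma u ->
    (forall z, Sigma z -> `|u z| <= B) -> mu.-integrable Sigma (EFin \o u).
  exact: bounded_integrable.
have mgn : measurable_fun Sigma (fun z => g (iter n F z)).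
  apply: (measurable_comp mS _ mg (measurable_iter n mS FS mF)).
  by move=> _ /= [z Sz <-]; exact: iter_stable.
have gnN z : Sigma z -> `|g (iter n F z)| <= N.
  by move=> Sz; apply: gN; exact: iter_stable.
have if_ := iS _ _ mf fM.
have ig := iS _ _ mg gN.
have igf := integrable_bounded_mul mS mgn gnN if_.
(* centering [g] bounds it by its Lipschitz constant *)
pose g' z := g z - g (0, 0).
have g'L : lip_with L g'.
  by move=> p q Sp Sq; rewrite /g' opprB addrA subrK; exact: gL.
have g'le z : Sigma z -> `|g' z| <= L.
  move=> Sz; rewrite (le_trans (gL _ _ Sz (Sigma0 R)))// ler_piMr//.
  exact: supdist0_le1.
pose k := n./2; pose j := (n - k)%N.
have kj : (k + j)%N = n by rewrite subnKC// (leq_trans (half_leq_subn n)) ?leq_subr.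
have := centered_correlation_bound mF FS muS muF (ltW C0) decay (ltW lam0_gt0) contr
  k j L0 g'L g'le M0 mf fM ffb bvfb (mulr_ge0 (normr_ge0 K) l0) fbV.
rewrite kj.
(* Both terms of the correlation change by [g (0, 0)] times the integral of [f], so the centring
   cancels. *)
have -> : \int[mu]_(z in Sigma) g' z = \int[mu]_(z in Sigma) g z - g (0, 0).
  exact: (Rintegral_shift mS muS (g (0, 0)) ig).
have -> : \int[mu]_(z in Sigma) (g' (iter n F z) * f z) =
    \int[mu]_(z in Sigma) (g (iter n F z) * f z) -
    g (0, 0) * \int[mu]_(z in Sigma) f z.
  have igf0 : mu.-integrable Sigma (EFin \o (fun z => g (0, 0) * f z)).
    exact (integrableZl mS (g (0, 0)) if_).
  rewrite -(RintegralZl (g (0, 0)) mS if_) -(RintegralB mS igf igf0).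
  by apply: eq_Rintegral => z _; rewrite mulrBl.
rewrite gLE /lipnorm flE fME (EFin_Rintegral mS igf) (EFin_Rintegral mS if_).
rewrite (EFin_Rintegral mS ig) -!EFinM -EFinB abse_EFin lee_fin.
set I1 := \int[mu]_(z in Sigma) (g _ * _).
set I2 := \int[mu]_(z in Sigma) f _; set I3 := \int[mu]_(z in Sigma) g _.
rewrite (_ : _ - _ = I1 - I2 * I3); last by lra.
move=> /le_trans; apply.
have kn : (n./2 <= k)%N by [].
have jn : (n./2 <= j)%N := half_leq_subn n.
set E := expR (a / 2) * expR (- (a / 2) * n%:R).
have lamk : lam0 ^+ k <= E.
  apply: le_trans (expR_half_le (ltW a_gt0) kn).
  rewrite -[lam0 in leLHS]lnK ?posrE// -expRM_natr ler_expR.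
  by rewrite ler_wpM2r// lerNr ge_min lexx orbT.
have expj : expR (- lam * j%:R) <= E.
  apply: le_trans (expR_half_le (ltW a_gt0) jn).
  by rewrite ler_expR ler_wpM2r// lerN2 ge_min lexx.
have E0 : 0 <= E by rewrite mulr_ge0 ?expR_ge0.
have K0 := normr_ge0 K; have C_ge0 := ltW C0.
have CL0 : 0 <= C * L * (M + 2 * (`|K| * l)).
  by rewrite ?(mulr_ge0, addr_ge0).
(* The surplus created by enlarging [M] and [l] separately to [M + l], the Lipschitz norm of [f]. *)
have rest : 0 <= L * E * (2 * l + C * (l + 2 * `|K| * M)).
  by rewrite ?(mulr_ge0, addr_ge0).
have := ler_wpM2l (mulr_ge0 L0 M0) lamk.
have := ler_wpM2l CL0 expj.
have -> : C' * L * (M + l) * expR (- (a / 2) * n%:R) =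
    2 * (L * M * E) + C * L * (M + 2 * (`|K| * l)) * E +
    L * E * (2 * l + C * (l + 2 * `|K| * M)).
  by rewrite /C' /E; ring.
by lra.
Qed.
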